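(* Consider the single energy arrival problem. The equation $$\left(\frac{T_\delta}{a}+\frac1b\right)e^{bt_0}-\frac1b=\left(\frac{T_\delta b}{a}+1\right)t_0e^{bt_0}$$ has a solution $t_0>0$. (i) Suppose $t_0<D$ and let $$P^*(t)=\begin{cases}\left(\frac{T_\delta b}{a}+1\right)e^{-b(t-t_0)}-1, & 0\le t<t_0,\\ \frac{T_\delta b}{a}, & t_0\le t\le D.\end{cases}$$ If $E\ge\int_0^DP^*(\tau)\,d\tau$, then $P^*$ is the optimal policy, and the resulting temperature is $T(t)=a\left(\frac{T_\delta b}{a}+1\right)te^{-b(t-t_0)}+\frac ab e^{-bt}-\frac ab+T_e$ for $0\le t\le t_0$ and $T(t)=T_c$ for $t_0\le t\le D$. (ii) Suppose $D<t_0$ and let $$P^*(t)=\frac1D\left(\left(\frac{T_\delta}{a}+\frac1b\right)e^{bD}-\frac1b\right)e^{-bt}-1,\qquad 0\le t\le D.$$ If $E\ge\int_0^DP^*(\tau)\,d\tau$, then $P^*$ is the optimal policy.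
   Context: Single energy arrival problem: fix a deadline $D>0$, an available energy $E>0$, constants $a,b>0$, an environment temperature $T_e$ and a critical temperature $T_c>T_e$; set $T_\delta=T_c-T_e$. A power policy is a measurable function $P:[0,D]\to[0,\infty)$. The resulting temperature $T(t)$ solves $\frac{d}{dt}T(t)=aP(t)-b(T(t)-T_e)$, $T(0)=T_e$, i.e. $T(t)=T_e+e^{-bt}\int_0^t ae^{b\tau}P(\tau)\,d\tau$. The optimal policy is the maximizer of $\int_0^D\frac12\log_2(1+P(\tau))\,d\tau$ over power policies satisfying $T(t)\le T_c$ for all $t\in[0,D]$ and $\int_0^DP(\tau)\,d\tau\le E$. It is unique almost everywhere; statements identifying it are understood up to null sets. *)

(* Defs.v *)
From HB Require Import structures.
From mathcomp Require Import all_boot all_order all_algebra.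
From mathcomp Require Import all_classical all_reals all_analysis.

Set Implicit Arguments.
Unset Strict Implicit.
Unset Printing Implicit Defensive.

Import Order.TTheory GRing.Theory Num.Theory.
Import numFieldNormedType.Exports.

Local Open Scope classical_set_scope.
Local Open Scope ring_scope.

Definition log2 (R : realType) (x : R) : R := ln x / ln 2.

(* A power policy on [0, D] is represented by a function on all of R of which
   only the values on [0, D] are ever used. *)
Definition power_policy (R : realType) (D : R) (P : R -> R) : Prop :=
  measurable_fun `[0, D] P /\ (forall t, 0 <= t <= D -> 0 <= P t).

(* Solution of T' = a P - b (T - Te), T(0) = Te, by variation of constants.
   This integral and the two below have nonnegative integrands and are taken in
   the extended reals, so that a non-integrable P has an infinite temperature
   and an infinite energy, and hence is never feasible. *)
Definition temperature (R : realType) (a b Te : R) (P : R -> R) (t : R)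
    : \bar R :=
  (Te%:E + (expR (- (b * t)))%:E *
    \int[lebesgue_measure]_(x in `[0%R, t]) (a * expR (b * x) * P x)%:E)%E.

Definition energy (R : realType) (D : R) (P : R -> R) : \bar R :=
  (\int[lebesgue_measure]_(x in `[0%R, D]) (P x)%:E)%E.

Definition throughput (R : realType) (D : R) (P : R -> R) : \bar R :=
  (\int[lebesgue_measure]_(x in `[0%R, D]) (2^-1 * log2 (1 + P x))%:E)%E.

Definition feasible (R : realType) (D E a b Te Tc : R) (P : R -> R) : Prop :=
  [/\ power_policy D P,
      forall t, 0 <= t <= D -> (temperature a b Te P t <= Tc%:E)%E
    & (energy D P <= E%:E)%E].

Definition maximizer (R : realType) (D E a b Te Tc : R) (P : R -> R) : Prop :=
  feasible D E a b Te Tc P /\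
  (forall Q, feasible D E a b Te Tc Q ->
     (throughput D Q <= throughput D P)%E).

Definition optimal_policy (R : realType) (D E a b Te Tc : R) (P : R -> R)
    : Prop :=
  maximizer D E a b Te Tc P /\
  (forall Q, maximizer D E a b Te Tc Q ->
     Q = P %[ae (@lebesgue_measure R) in [set` `[0, D]]]).

(* [Td] stands for Tc - Te. *)
Definition t0_equation (R : realType) (a b Td t0 : R) : Prop :=
  (Td / a + 1 / b) * expR (b * t0) - 1 / b =
  (Td * b / a + 1) * t0 * expR (b * t0).

Definition Pstar_long (R : realType) (a b Td t0 : R) (t : R) : R :=
  if t < t0 then (Td * b / a + 1) * expR (- (b * (t - t0))) - 1
  else Td * b / a.

Definition Pstar_short (R : realType) (D a b Td : R) (t : R) : R :=
  1 / D * ((Td / a + 1 / b) * expR (b * D) - 1 / b) * expR (- (b * t)) - 1.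

(* Main.v *)
(** Since [ln (1 + q) <= ln (1 + p) + (q - p) / (1 + p)], with equality only for
    [q = p], a feasible [P] is the unique optimal policy as soon as every
    feasible [Q] satisfies [int Q / (1 + P) <= int P / (1 + P)].  Here
    [1 / (1 + P x)] is [expR (b * x)] times a nonincreasing positive weight;
    writing the weight at [x] as its value at [D] plus an integral over [[x, D]]
    and exchanging the integrals turns [int Q / (1 + P)] into a positive
    combination of the accumulated heats [int_0^s a * expR (b * x) * Q x], each
    bounded by [(Tc - Te) * expR (b * s)] by the temperature constraint, with
    equality for [P].  With [K = (Tc - Te) * b / a + 1], the equation defining
    [t0] reads [K * expR (b * t0) * (1 - b * t0) = 1]; the feasibility of [P]
    is then a tangent line inequality for the exponential. *)

Require Import Defs.
From HB Require Import structures.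
From mathcomp Require Import all_boot all_order all_algebra.
From mathcomp Require Import ring lra.
From mathcomp Require Import all_classical all_reals all_analysis.
From mathcomp Require Import measurable_realfun.

Set Implicit Arguments.
Unset Strict Implicit.
Unset Printing Implicit Defensive.

Import Order.TTheory GRing.Theory Num.Theory.
Import numFieldNormedType.Exports.

Local Open Scope classical_set_scope.
Local Open Scope ring_scope.

(** * Integrals of piecewise functions and exchange of integrals on a triangle *)

Section integrals.
Context {R : realType}.
Notation mu := (@lebesgue_measure R).
Implicit Types (u m v : R) (f g F G : R -> R).

Lemma integral_FTC f F u v : u <= v ->
  (forall x : R, is_derive x 1 F (f x)) -> continuous f ->
  (\int[mu]_(x in `[u, v]) (f x)%:E = (F v - F u)%:E)%E.
Proof.
rewrite le_eqVlt => /predU1P[->|uv] dF cf.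
  by rewrite set_itv1 integral_set1 subrr.
have cF x : {for x, continuous F}.
  by apply: differentiable_continuous; apply/derivable1_diffP; case: (dF x).
rewrite (@continuous_FTC2 _ f F)//.
- exact: continuous_subspaceT.
- split.
  + by move=> x _; case: (dF x).
  + exact/cvg_at_right_filter/cF.
  + exact/cvg_at_left_filter/cF.
- by move=> x _; rewrite derive1E; case: (dF x).
Qed.

(** The signs of [f] and [g] allow splitting the integral at [m] by additivity for nonnegative
    integrands; closing [[u, m[] at [m] adds only a null set. *)
Lemma integral_FTC_glue f F g G u m v : u <= m <= v ->
  (forall x : R, is_derive x 1 F (f x)) -> continuous f ->
  (forall x : R, is_derive x 1 G (g x)) -> continuous g ->
  (forall x, u <= x <= m -> 0 <= f x) -> (forall x, m <= x <= v -> 0 <= g x) ->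
  (\int[mu]_(x in `[u, v]) (if x < m then f x else g x)%:E
   = (F m - F u + (G v - G m))%:E)%E.
Proof.
move=> /andP[um mv] dF cf dG cg f0 g0.
have mh : measurable_fun [set: R] (fun x => if x < m then f x else g x).
  apply: measurable_fun_ifT; first exact: measurable_fun_ltr.
  - exact: continuous_measurable_fun.
  - exact: continuous_measurable_fun.
rewrite (@itv_bndbnd_setU _ _ _ (BLeft m))//.
rewrite ge0_integral_setU//=; last 3 first.
- by apply/measurable_EFinP; exact: measurable_funTS.
- move=> x [|] /=; rewrite in_itv/= => /andP[h1 h2]; rewrite lee_fin.
    by rewrite h2 f0// h1 ltW.
  by rewrite ltNge h1/= g0// h1 h2.
- apply/disj_setPS => x []/=; rewrite !in_itv/= => /andP[_ +] /andP[+ _].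
  by rewrite ltNge => /negP.
rewrite EFinD; congr (_ + _)%E.
- transitivity (\int[mu]_(x in `[u, m[) (f x)%:E)%E.
    by apply: eq_integral => x; rewrite inE/= in_itv/= => /andP[_ ->].
  rewrite integral_itv_bndo_bndc; first exact: integral_FTC.
  apply/measurable_EFinP; apply: measurable_funTS.
  exact: continuous_measurable_fun.
- rewrite -integral_FTC//; apply: eq_integral => x.
  by rewrite inE/= in_itv/= => /andP[+ _]; rewrite ltNge => ->.
Qed.

(** Tonelli on the triangle [x <= s <= D]: after the exchange the inner integral is [v s] times the
    integral of [q] over [[0, s]], which [Y s] bounds. *)
Lemma tonelli_triangle_le (q v Y : R -> R) (D : R) :
  measurable_fun `[0, D] q -> (forall x, 0 <= x <= D -> 0 <= q x) ->
  measurable_fun [set: R] v -> (forall x, 0 <= v x) ->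
  measurable_fun `[0, D] Y ->
  (forall s, 0 <= s <= D ->
    (\int[mu]_(x in `[0%R, s]) (q x)%:E <= (Y s)%:E)%E) ->
  (\int[mu]_(x in `[0%R, D]) ((q x)%:E * \int[mu]_(s in `[x, D]) (v s)%:E)
   <= \int[mu]_(s in `[0%R, D]) (v s * Y s)%:E)%E.
Proof.
move=> mq q0 mv v0 mY qY.
(* Extension by zero gives an integrand [h] that is measurable on the whole plane, with the triangle
   encoded as a cutoff. *)
pose q' := q \_ `[0, D].
have mq' : measurable_fun setT q' by exact/(measurable_restrictT _ _).1.
have q'0 x : 0 <= q' x.
  by rewrite /q' patchE; case: ifPn => //; rewrite inE/= in_itv/= => /q0.
pose h (z : R * R) : \bar R :=
  (if (z.1 <= z.2) && (z.2 <= D) then q' z.1 * v z.2 else 0)%:E.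
have h0 z : (0 <= h z)%E.
  by rewrite /h lee_fin; case: ifPn => // _; rewrite mulr_ge0.
have mh : measurable_fun setT h.
  apply/measurable_EFinP; apply: measurable_fun_ifT => //.
  - apply: measurable_and; first exact: measurable_fun_ler.
    by apply: measurable_fun_ler => //; exact: measurable_snd.
  - apply: measurable_funM.
      exact: (measurableT_comp mq' measurable_fst).
    exact: (measurableT_comp mv measurable_snd).
have H := @fubini_tonelli _ _ _ _ R mu mu h mh h0.
rewrite [leRHS]integral_mkcond [leLHS]integral_mkcond.
apply: (@le_trans _ _ (\int[mu]_x \int[mu]_y h (x, y))%E); last rewrite H.
- rewrite le_eqVlt; apply/orP; left; apply/eqP.
  apply: eq_integral => x _; rewrite patchE; case: ifPn; last first.
    move=> xD; rewrite integral0_eq// => y _.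
    by rewrite /h/= /q' patchE (negbTE xD) mul0r; case: ifP.
  move=> xD; rewrite -ge0_integralZl//=; last 3 first.
  - by apply/measurable_EFinP; exact: measurable_funTS.
  - by move=> s _; rewrite lee_fin.
  - by move: xD; rewrite inE/= in_itv/= => /q0.
  rewrite integral_mkcond; apply: eq_integral => y _.
  rewrite patchE /h/= mem_setE in_itv/= /q' patchE xD.
  by case: ifP.
- have Y0 s : 0 <= s <= D -> 0 <= Y s.
    move=> sD; rewrite -lee_fin; apply: le_trans (qY s sD).
    apply: integral_ge0 => x /=; rewrite in_itv/= => /andP[x0 xs].
    by move: sD => /andP[s0 sD]; rewrite lee_fin q0// x0 (le_trans xs).
  apply: ge0_le_integral => //.
  + by move=> s _; apply: integral_ge0.
  + exact: measurable_fun_fubini_tonelli_G.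
  + apply/(measurable_restrictT _ _).1 => //; apply/measurable_EFinP.
    by apply: measurable_funM => //; exact: measurable_funTS.
  (* Off [[0, D]] the inner integral vanishes: for [s < 0] because [q'] is zero below [0], for
     [s > D] by the cutoff in [h]. *)
  move=> s _; rewrite patchE; case: ifPn; last first.
    rewrite mem_setE in_itv/= negb_and => /orP sD.
    rewrite integral0_eq// => y _; rewrite /h/= /q' patchE mem_setE in_itv/=.
    case: ifPn => // /andP[ys ysD]; case: ifPn; last by rewrite mul0r.
    move=> /andP[y0 _]; case: sD; last by rewrite ysD.
    by rewrite (le_trans y0 ys).
  rewrite mem_setE in_itv/= => /andP[s0 sD].
  apply: (@le_trans _ _ ((v s)%:E * \int[mu]_(x in `[0%R, s]) (q x)%:E))%E.
    rewrite -ge0_integralZl//=; last 3 first.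
    - apply/measurable_EFinP; apply: measurable_funS mq => //.
      by apply: subset_itvl; rewrite bnd_simp.
    - move=> x; rewrite in_itv/= => /andP[x0 xs].
      by rewrite lee_fin q0// x0 (le_trans xs).
    - by rewrite lee_fin.
    rewrite le_eqVlt; apply/orP; left; apply/eqP.
    rewrite [RHS]integral_mkcond; apply: eq_integral => x _.
    rewrite patchE /h/= mem_setE in_itv/= sD andbT /q' patchE mem_setE in_itv/=.
    case: (leP x s) => [xs|_]; last by rewrite andbF.
    rewrite (le_trans xs sD) !andbT; case: ifPn => _; first by rewrite mulrC.
    by rewrite mul0r.
  by rewrite EFinM lee_wpmul2l ?lee_fin// qY// s0.
Qed.

(** The constant part [w] of the weight is controlled by the bound at [D] alone; the part [V x] is
    an integral over [[x, D]], to which [tonelli_triangle_le] applies. *)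
Lemma integral_weight_le (q v V Y : R -> R) (D w : R) : 0 <= D -> 0 <= w ->
  measurable_fun `[0, D] q -> (forall x, 0 <= x <= D -> 0 <= q x) ->
  measurable_fun [set: R] v -> (forall x, 0 <= v x) ->
  measurable_fun `[0, D] V ->
  (forall x, 0 <= x <= D -> (\int[mu]_(s in `[x, D]) (v s)%:E = (V x)%:E)%E) ->
  measurable_fun `[0, D] Y ->
  (forall s, 0 <= s <= D ->
    (\int[mu]_(x in `[0%R, s]) (q x)%:E <= (Y s)%:E)%E) ->
  (\int[mu]_(x in `[0%R, D]) (q x * (w + V x))%:E
   <= (w * Y D)%:E + \int[mu]_(s in `[0%R, D]) (v s * Y s)%:E)%E.
Proof.
move=> D0 w0 mq q0 mv v0 mV vV mY qY.
have V0 x : 0 <= x <= D -> 0 <= V x.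
  by move=> xD; rewrite -lee_fin -vV//; apply: integral_ge0 => s _; rewrite lee_fin.
rewrite (_ : integral _ _ _ = \int[mu]_(x in `[0%R, D])
    (w%:E * (q x)%:E + (q x * V x)%:E))%E; last first.
  apply: eq_integral => x _; rewrite -EFinM -EFinD; congr EFin.
  by rewrite mulrDr [w * _]mulrC.
rewrite ge0_integralD//=; last 4 first.
- by move=> x; rewrite in_itv/= => xD; rewrite mule_ge0// lee_fin ?q0.
- by apply/measurable_EFinP; exact: measurable_funM.
- by move=> x; rewrite in_itv/= => xD; rewrite lee_fin mulr_ge0 ?q0 ?V0.
- by apply/measurable_EFinP; exact: measurable_funM.
rewrite ge0_integralZl//=; last first.
  exact/measurable_EFinP.
apply: leeD.
  by rewrite EFinM lee_wpmul2l ?lee_fin// qY// D0 lexx.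
have := tonelli_triangle_le mq q0 mv v0 mY qY; apply: le_trans.
rewrite le_eqVlt; apply/orP; left; apply/eqP.
by apply: eq_integral => x; rewrite inE/= in_itv/= => xD; rewrite vV.
Qed.

End integrals.

(** * Optimality from the tangent line of the logarithm *)

Section concavity.
Context {R : realType}.
Notation mu := (@lebesgue_measure R).
Implicit Types (D : R) (P Q : R -> R).

(** This is [1 + y <= expR y] at [y = ln ((1 + q) / (1 + p))]. *)
Lemma ln_gap_ge0 (p q : R) : 0 <= p -> 0 <= q ->
  0 <= ln (1 + p) - ln (1 + q) + (q - p) / (1 + p).
Proof.
move=> p0 q0.
have p1 : 0 < 1 + p by lra.
have q1 : 0 < 1 + q by lra.
have -> : (q - p) / (1 + p) = (1 + q) / (1 + p) - 1 by field; lra.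
have := expR_ge1Dx (ln ((1 + q) / (1 + p))).
by rewrite lnK ?posrE ?divr_gt0// ln_div ?posrE//; lra.
Qed.

(** Grouped so that for nonnegative [p] and [q] every summand is nonnegative, which lets the
    identity be integrated term by term in the extended reals. *)
Lemma ln_gapE (p q : R) : 0 <= p ->
  ln (1 + q) + (ln (1 + p) - ln (1 + q) + (q - p) / (1 + p)) + p / (1 + p) =
  ln (1 + p) + q / (1 + p).
Proof. by move=> p0; field; lra. Qed.

(** The inequality [1 + y < expR y] is strict for [y != 0], so a zero gap forces equal
    logarithms. *)
Lemma ln_gap_eq0 (p q : R) : 0 <= p -> 0 <= q ->
  ln (1 + p) - ln (1 + q) + (q - p) / (1 + p) = 0 -> q = p.
Proof.
move=> p0 q0.
have p1 : 0 < 1 + p by lra.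
have q1 : 0 < 1 + q by lra.
have -> : (q - p) / (1 + p) = (1 + q) / (1 + p) - 1 by field; lra.
have [l0 _|l0] := eqVneq (ln (1 + q)) (ln (1 + p)).
  by move: l0 => /ln_inj; rewrite !posrE => /(_ q1 p1); lra.
have : ln ((1 + q) / (1 + p)) != 0 by rewrite ln_div ?posrE// subr_eq0.
move=> /expR_gt1Dx.
by rewrite lnK ?posrE ?divr_gt0// ln_div ?posrE//; lra.
Qed.

Lemma measurable_ln1D D P : measurable_fun `[0, D] P ->
  measurable_fun `[0, D] (fun x => ln (1 + P x)).
Proof.
move=> mP; apply: measurableT_comp; first exact: measurable_ln.
exact: measurable_funD.
Qed.

Lemma measurable_div1D D P Q : power_policy D P -> measurable_fun `[0, D] Q ->
  measurable_fun `[0, D] (fun x => Q x / (1 + P x)).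
Proof.
move=> [mP P0] mQ; apply: measurable_funM => //.
(* The inverse of [1 + P] is rewritten through [expR] and [ln], both measurable; the two forms agree
   where [1 + P] is positive. *)
apply: (eq_measurable_fun (fun x => expR (- ln (1 + P x)))).
  move=> x; rewrite inE/= in_itv/= => /P0 Px.
  by rewrite expRN lnK// posrE; lra.
apply: measurableT_comp; first exact: measurable_expR.
by apply: measurableT_comp => //; exact: measurable_ln1D.
Qed.

Lemma ln1D_ge0 (p : R) : 0 <= p -> 0 <= ln (1 + p).
Proof. by move=> p0; rewrite ln_ge0// lerDl. Qed.

Lemma throughputE D P : power_policy D P ->
  throughput D P =
  ((2^-1 / ln 2)%:E * \int[mu]_(x in `[0%R, D]) (ln (1 + P x))%:E)%E.
Proof.
move=> [mP P0]; rewrite /throughput -ge0_integralZl//=.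
- by apply: eq_integral => x _; rewrite -EFinM; congr EFin; rewrite /log2; ring.
- by apply/measurable_EFinP; exact: measurable_ln1D.
- by move=> x; rewrite in_itv/= => /P0 Px; rewrite lee_fin ln1D_ge0.
- by rewrite lee_fin divr_ge0// ln_ge0//; lra.
Qed.

Lemma throughput_fin_num D P : power_policy D P -> (energy D P < +oo)%E ->
  throughput D P \is a fin_num.
Proof.
move=> PP EP; have [mP P0] := PP; rewrite throughputE//.
apply: fin_numM => //; rewrite ge0_fin_numE; last first.
  apply: integral_ge0 => x; rewrite /= in_itv/= => /P0 Px.
  by rewrite lee_fin ln1D_ge0.
apply: le_lt_trans EP; apply: ge0_le_integral => //=.
- by move=> x; rewrite in_itv/= => /P0 Px; rewrite lee_fin ln1D_ge0.
- by apply/measurable_EFinP; exact: measurable_ln1D.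
- exact/measurable_EFinP.
- by move=> x; rewrite in_itv/= => /P0 Px; rewrite lee_fin le_ln1Dx//; lra.
Qed.

(** The integral of the gap bounds from below what [Q] loses against [P]. Its nonnegativity gives
    the inequality; when nothing is lost, the gap vanishes almost everywhere and [ln_gap_eq0]
    applies. *)
Lemma tangent_throughput D (A : R) P Q :
  power_policy D P -> power_policy D Q -> (energy D P < +oo)%E ->
  (\int[mu]_(x in `[0%R, D]) (P x / (1 + P x))%:E = A%:E)%E ->
  (\int[mu]_(x in `[0%R, D]) (Q x / (1 + P x))%:E <= A%:E)%E ->
  (throughput D Q <= throughput D P)%E /\
  ((throughput D P <= throughput D Q)%E -> Q = P %[ae mu in [set` `[0, D]]]).
Proof.
move=> PP PQ EP PA QA; have [mP P0] := PP; have [mQ Q0] := PQ.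
pose gap x := ln (1 + P x) - ln (1 + Q x) + (Q x - P x) / (1 + P x).
have gap0 x : 0 <= x <= D -> 0 <= gap x.
  by move=> xD; rewrite ln_gap_ge0 ?P0 ?Q0.
have mgap : measurable_fun `[0, D] gap.
  apply: measurable_funD; first by apply: measurable_funB; exact: measurable_ln1D.
  by apply: measurable_div1D => //; exact: measurable_funB.
have c0 : 0 < 2^-1 / ln 2 :> R by rewrite divr_gt0// ln_gt0//; lra.
set I := fun f : R -> R => (\int[mu]_(x in `[0%R, D]) (f x)%:E)%E.
have ID (f g : R -> R) : measurable_fun `[0, D] f -> measurable_fun `[0, D] g ->
    (forall x, 0 <= x <= D -> 0 <= f x) -> (forall x, 0 <= x <= D -> 0 <= g x) ->
    I (f \+ g) = (I f + I g)%E.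
  move=> mf mg f0 g0; rewrite /I -ge0_integralD//=.
  - exact/measurable_EFinP.
  - exact/measurable_EFinP.
have lP0 x : 0 <= x <= D -> 0 <= ln (1 + P x) by move/P0/ln1D_ge0.
have lQ0 x : 0 <= x <= D -> 0 <= ln (1 + Q x) by move/Q0/ln1D_ge0.
have dP0 x : 0 <= x <= D -> 0 <= P x / (1 + P x).
  by move=> /P0 Px; rewrite divr_ge0//; lra.
have dQ0 x : 0 <= x <= D -> 0 <= Q x / (1 + P x).
  by move=> xD; have := P0 _ xD; have := Q0 _ xD => *; rewrite divr_ge0//; lra.
have mlP := measurable_ln1D mP; have mlQ := measurable_ln1D mQ.
have mdP := measurable_div1D PP mP; have mdQ := measurable_div1D PP mQ.
pose lP x := ln (1 + P x); pose lQ x := ln (1 + Q x).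
pose dQ x := Q x / (1 + P x).
(* Both sides are increased by the finite [A], on the left in the form of the integral of
   [P / (1 + P)]; [ln_gapE] then matches the integrands without subtracting integrals. *)
have key : (I lQ + I gap <= I lP)%E.
  rewrite -(leeD2rE (x := A%:E))// -{1}PA -/(I _) -!ID//; last 2 first.
  - by apply: measurable_funD.
  - by move=> x xD; rewrite /= addr_ge0 ?gap0 ?lQ0.
  apply: (@le_trans _ _ (I lP + I dQ)%E); last first.
    by rewrite leeD2l.
  rewrite -ID// /I le_eqVlt; apply/orP; left; apply/eqP.
  apply: eq_integral => x; rewrite inE/= in_itv/= => /P0 Px; congr EFin.
  by have tangent := ln_gapE (Q x) Px; exact tangent.
(* Finiteness passes back through the positive factor of [throughputE]; it justifies the
   cancellation behind [Igap]. *)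
have lPfin : I lP \is a fin_num.
  have := throughput_fin_num PP EP; rewrite throughputE// -/(I _) => fin.
  have : (0 <= I lP)%E.
    by apply: integral_ge0 => x; rewrite /= in_itv/= lee_fin => /lP0.
  rewrite -/lP in fin *; case: (I lP) fin => //=.
  by rewrite gt0_muley ?lte_fin.
have Igap0 : (0 <= I gap)%E.
  by apply: integral_ge0 => x; rewrite /= in_itv/= lee_fin => /gap0.
have lQP : (I lQ <= I lP)%E by apply: le_trans key; rewrite leeDl.
split.
  by rewrite !throughputE// lee_pmul2l ?lte_fin.
rewrite !throughputE// lee_pmul2l ?lte_fin// -/(I _) -/(I _) => lPQ.
have {}lPQ : I lQ = I lP by apply/eqP; rewrite eq_le lQP.
have Igap : I gap = 0%E.
  apply/eqP; rewrite eq_le Igap0 andbT.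
  by move: key; rewrite lPQ -[leRHS]adde0 leeD2lE.
have : (EFin \o gap) = cst 0%E %[ae mu in [set` `[0, D]]].
  apply/ae_eq_integral_abs => //; first exact/measurable_EFinP.
  rewrite -[RHS]Igap; apply: eq_integral => x.
  by rewrite inE/= in_itv/= => /gap0 gx; rewrite ger0_norm.
move=> [N [mN N0 gapN]]; exists N; split => //; apply: subset_trans gapN.
apply: subsetC => x /= + xD => /(_ xD) [] gx.
by move: xD; rewrite /= in_itv/= => xD; apply: ln_gap_eq0 (P0 _ xD) (Q0 _ xD) gx.
Qed.

Lemma optimal_policy_of_tangent D (E a b Te Tc A : R) P :
  feasible D E a b Te Tc P ->
  (\int[mu]_(x in `[0%R, D]) (P x / (1 + P x))%:E = A%:E)%E ->
  (forall Q, feasible D E a b Te Tc Q ->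
    (\int[mu]_(x in `[0%R, D]) (Q x / (1 + P x))%:E <= A%:E)%E) ->
  optimal_policy D E a b Te Tc P.
Proof.
move=> fP PA QA; have [PP _ EP] := fP.
have {}EP : (energy D P < +oo)%E by apply: le_lt_trans EP _; rewrite ltry.
split.
  split=> // Q fQ; have [PQ _ _] := fQ.
  by have [] := tangent_throughput PP PQ EP PA (QA _ fQ).
move=> Q [fQ maxQ]; have [PQ _ _] := fQ.
by have [_] := tangent_throughput PP PQ EP PA (QA _ fQ); apply; exact: maxQ.
Qed.

End concavity.

(** * Integrals of affine functions of an exponential *)

Section affine_exponential.
Context {R : realType}.
Implicit Types (k c g : R).

(** With the coefficient written [c * g] the primitive needs no division by [g], so [g := 0] covers
    constant integrands. *)
Lemma is_derive_affexp k c g (x : R) :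
  is_derive x 1 (fun y => k * y + c * expR (g * y)) (k + c * g * expR (g * x)).
Proof.
have dg : is_derive x 1 (fun y : R => g * y) g.
  by apply: is_derive_eq; rewrite ?scaler0 ?addr0 /GRing.scale/= ?mulr1.
have de : is_derive x 1 (fun y : R => expR (g * y)) (expR (g * x) * g).
  exact: is_derive1_comp.
have dk : is_derive x 1 (fun y : R => k * y) k.
  by apply: is_derive_eq; rewrite ?scaler0 ?addr0 /GRing.scale/= ?mulr1.
have dc : is_derive x 1 (fun y : R => c * expR (g * y)) (c * (expR (g * x) * g)).
  by apply: is_derive_eq; rewrite /GRing.scale/=; ring.
by apply: is_derive_eq; ring.
Qed.

Lemma continuous_affexp k c g :
  continuous (fun x : R => k + c * expR (g * x)).
Proof.
move=> x; apply: cvgD; first exact: cvg_cst.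
apply: cvgM; first exact: cvg_cst.
apply: continuous_comp; last exact: continuous_expR.
by apply: cvgM; [exact: cvg_cst|exact: cvg_id].
Qed.

Lemma integral_affexp k c g (h : R -> R) (u v : R) : u <= v ->
  (forall x, u <= x <= v -> h x = k + c * g * expR (g * x)) ->
  (\int[lebesgue_measure]_(x in `[u, v]) (h x)%:E
   = (k * v + c * expR (g * v) - (k * u + c * expR (g * u)))%:E)%E.
Proof.
move=> uv hE.
rewrite -(integral_FTC uv (is_derive_affexp k c g) (@continuous_affexp k (c * g) g)).
by apply: eq_integral => x; rewrite inE/= in_itv/= => /hE ->.
Qed.

Lemma integral_affexp_glue k c g k' c' g' (h : R -> R) (u m v : R) :
  u <= m <= v ->
  (forall x, u <= x < m -> h x = k + c * g * expR (g * x)) ->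
  (forall x, m <= x <= v -> h x = k' + c' * g' * expR (g' * x)) ->
  (forall x, u <= x <= m -> 0 <= k + c * g * expR (g * x)) ->
  (forall x, m <= x <= v -> 0 <= k' + c' * g' * expR (g' * x)) ->
  (\int[lebesgue_measure]_(x in `[u, v]) (h x)%:E
   = (k * m + c * expR (g * m) - (k * u + c * expR (g * u)) +
      (k' * v + c' * expR (g' * v) - (k' * m + c' * expR (g' * m))))%:E)%E.
Proof.
move=> umv hE1 hE2 h10 h20.
rewrite -(integral_FTC_glue umv (is_derive_affexp k c g)
  (@continuous_affexp k (c * g) g) (is_derive_affexp k' c' g')
  (@continuous_affexp k' (c' * g') g') h10 h20).
apply: eq_integral => x; rewrite inE/= in_itv/= => /andP[ux xv].
by case: ltP => xm; [rewrite hE1 ?ux|rewrite hE2 ?xm].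
Qed.

End affine_exponential.

(** * Temperature and accumulated heat *)

Section temperature.
Context {R : realType}.
Notation mu := (@lebesgue_measure R).
Variables (a b Te Tc : R).
Hypotheses (a_gt0 : 0 < a) (b_gt0 : 0 < b).

Lemma temperature_fin P t (H : R) :
  (\int[mu]_(x in `[0%R, t]) (a * expR (b * x) * P x)%:E = H%:E)%E ->
  temperature a b Te P t = (Te + expR (- (b * t)) * H)%:E.
Proof. by move=> PH; rewrite /temperature PH EFinD EFinM. Qed.

(** An infinite heat would make the temperature infinite, which the finite bound [Tc] excludes; a
    finite one is isolated by multiplying by [expR (b * t)]. *)
Lemma heat_le_of_temperature_le P t : (temperature a b Te P t <= Tc%:E)%E ->
  (\int[mu]_(x in `[0%R, t]) (a * expR (b * x) * P x)%:E
   <= ((Tc - Te) * expR (b * t))%:E)%E.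
Proof.
rewrite /temperature; set H := integral _ _ _.
case: H => [h| |].
- rewrite -EFinM -EFinD !lee_fin => hT.
  by rewrite -ler_pdivrMr ?expR_gt0// -expRN mulrC lerBrDl.
- by rewrite gt0_muley ?lte_fin ?expR_gt0// addey// leye_eq.
- by rewrite leNye.
Qed.

Lemma heat_rate_ge0 D P : power_policy D P ->
  forall x, 0 <= x <= D -> 0 <= a * expR (b * x) * P x.
Proof.
by move=> [_ P0] x /P0 Px; rewrite !mulr_ge0 ?expR_ge0// ltW.
Qed.

Lemma measurable_heat_rate D P : power_policy D P ->
  measurable_fun `[0, D] (fun x => a * expR (b * x) * P x).
Proof.
move=> [mP _]; apply: measurable_funM => //.
apply: measurable_funM => //; exact: measurableT_comp.
Qed.

End temperature.

(** * The equation defining the critical time *)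

Section critical_time.
Context {R : realType}.
Variables (a b Td : R).
Hypotheses (a_gt0 : 0 < a) (b_gt0 : 0 < b) (Td_gt0 : 0 < Td).
Local Notation K := (Td * b / a + 1).

Lemma gt1_K : 1 < K.
Proof. by rewrite ltrDr divr_gt0// mulr_gt0. Qed.

(** The difference of the two sides of [t0_equation], multiplied by [b], is the difference of the
    two sides here. *)
Lemma t0_equationE t0 :
  t0_equation a b Td t0 <-> K * expR (b * t0) * (1 - b * t0) = 1.
Proof.
rewrite /t0_equation; set Z := expR _.
have a0 : a != 0 by rewrite gt_eqF.
have b0 : b != 0 by rewrite gt_eqF.
have E : K * Z * (1 - b * t0) - 1 =
    b * ((Td / a + 1 / b) * Z - 1 / b - K * t0 * Z) by field; apply/andP.
split => [e|e].
  by apply/eqP; rewrite -subr_eq0 E e subrr mulr0.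
apply/eqP; rewrite -subr_eq0 -(mulrI_eq0 _ (lregP b0)) -E e subrr//.
Qed.

Lemma t0_equation_solvable : exists t0, 0 < t0 /\ t0_equation a b Td t0.
Proof.
pose f (t : R) : R := K * expR (b * t) * (1 - b * t).
have cf : continuous f.
  have cb : continuous (fun t : R => b * t).
    by move=> t; apply: cvgM; [exact: cvg_cst|exact: cvg_id].
  move=> t; apply: cvgM; last first.
    by apply: cvgB; [exact: cvg_cst|exact: cb].
  apply: cvgM; first exact: cvg_cst.
  by apply: continuous_comp; [exact: cb|exact: continuous_expR].
have f0 : f 0 = K by rewrite /f mulr0 expR0 subr0 !mulr1.
have f1 : f b^-1 = 0 by rewrite /f mulfV ?gt_eqF// subrr mulr0.
have K1 := gt1_K.
(* At the ends of [[0, 1 / b]] the function takes the values [K > 1] and [0], so it passes through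
   [1], and not at [0]. *)
have [||t] := @IVT R f 0 b^-1 1 _ (continuous_subspaceT cf).
- by rewrite invr_ge0 ltW.
- by rewrite f0 f1 ge_min le_max ler01 orbT (ltW K1).
rewrite in_itv/= => /andP[t0 _] ft; exists t; split; last exact/t0_equationE.
rewrite lt_neqAle t0 andbT; apply/eqP => t0E; subst t.
by move: ft; rewrite f0 => KE; move: K1; rewrite KE ltxx.
Qed.

(** The function [expR x * (1 - x)] decreases for [x >= 0]; this is obtained from
    [1 - u <= expR (- u)], where [u] is the distance from [b * D] to [b * t0]. *)
Lemma before_t0 t0 D : K * expR (b * t0) * (1 - b * t0) = 1 ->
  0 <= D -> D <= t0 -> 1 <= K * expR (b * D) * (1 - b * D).
Proof.
move=> Kt0 D0 Dt0; set u := b * (t0 - D).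
have u0 : 0 <= u by rewrite mulr_ge0 ?subr_ge0// ltW.
have uE : 1 - u <= expR (- u) by have := expR_ge1Dx (- u).
have -> : expR (b * D) = expR (b * t0) * expR (- u).
  by rewrite -expRD; congr expR; rewrite /u; ring.
have Z0 := expR_gt0 (b * t0); set Z := expR (b * t0) in Kt0 Z0 *.
have K1 := gt1_K; set k := K in Kt0 K1 *.
have bD : 0 <= b * D by rewrite mulr_ge0// ltW.
have y0 : 0 < 1 - b * t0.
  have : 0 < k * Z * (1 - b * t0) by rewrite Kt0.
  by rewrite pmulr_rgt0// mulr_gt0//; lra.
have DE : b * D = b * t0 - u by rewrite /u; ring.
have kZ : 0 < k * Z by rewrite mulr_gt0//; lra.
(* The product [(1 - u) * (1 - b * D)] exceeds [1 - b * t0] by [u * (b * D)], and [1 - b * D] is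
   positive since [b * D <= b * t0 < 1]. *)
have le1 : (1 - b * t0) <= expR (- u) * (1 - b * D).
  apply: (@le_trans _ _ ((1 - u) * (1 - b * D))).
    by rewrite DE in bD *; nra.
  by rewrite ler_wpM2r//; lra.
rewrite -{1}Kt0 (_ : k * (Z * _) * _ = k * Z * (expR (- u) * (1 - b * D))).
  by rewrite ler_pM2l.
by ring.
Qed.

End critical_time.

(** * Deadline at or after the critical time *)

Section long_deadline.
Context {R : realType}.
Notation mu := (@lebesgue_measure R).
Variables (a b Te Tc t0 : R).
Hypotheses (a_gt0 : 0 < a) (b_gt0 : 0 < b) (Te_lt_Tc : Te < Tc).
Hypothesis t0_gt0 : 0 < t0.
Local Notation Td := (Tc - Te).
Local Notation K := (Td * b / a + 1).
Hypothesis Kt0 : K * expR (b * t0) * (1 - b * t0) = 1.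
Local Notation P := (Pstar_long a b Td t0).

Let a_neq0 : a != 0. Proof. by rewrite gt_eqF. Qed.
Let b_neq0 : b != 0. Proof. by rewrite gt_eqF. Qed.
Let Td_gt0 : 0 < Td. Proof. by rewrite subr_gt0. Qed.
Let K_gt1 : 1 < K. Proof. exact: gt1_K. Qed.
Let K_gt0 : 0 < K. Proof. exact: lt_trans ltr01 K_gt1. Qed.
Let K_neq0 : K != 0. Proof. by rewrite gt_eqF. Qed.
Let expR_neq0 (x : R) : expR x != 0. Proof. by rewrite gt_eqF ?expR_gt0. Qed.

Let expR_shift x : expR (- (b * (x - t0))) = expR (b * t0) / expR (b * x).
Proof. by rewrite -expRB; congr expR; ring. Qed.

(** The endpoint [t0] is included because both branches of the policy equal [K - 1] there;
    [- (a / b) * b] is kept in the shape of [integral_affexp]. *)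
Let heat_rate1 x : x <= t0 -> a * expR (b * x) * P x =
  a * K * expR (b * t0) + (- (a / b)) * b * expR (b * x).
Proof.
have X0 := expR_neq0 (b * x).
rewrite /Pstar_long; case: ltgtP => // [xt _|-> _].
  by rewrite expR_shift; field; rewrite a_neq0 b_neq0 X0.
by field; rewrite a_neq0 b_neq0.
Qed.

Let heat_rate2 x : t0 <= x -> a * expR (b * x) * P x =
  0 + Td * b * expR (b * x).
Proof. by move=> xt; rewrite /Pstar_long ltNge xt/=; field. Qed.

Lemma Pstar_long_ge0 x : 0 <= P x.
Proof.
rewrite /Pstar_long; case: ltP => xt; last first.
  by rewrite divr_ge0 ?mulr_ge0// ltW.
rewrite subr_ge0 -[leLHS]mulr1 ler_pM ?(ltW K_gt1)// -expR0 ler_expR.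
by rewrite -mulrN mulr_ge0 ?(ltW b_gt0)// oppr_ge0 subr_le0 ltW.
Qed.

Lemma power_policy_Pstar_long D : power_policy D P.
Proof.
split=> [|x _]; last exact: Pstar_long_ge0.
apply: measurable_funTS; apply: measurable_fun_ifT => //.
  exact: measurable_fun_ltr.
apply: measurable_funB => //; apply: measurable_funM => //.
apply: measurableT_comp => //; apply: measurableT_comp => //.
by apply: measurable_funM => //; exact: measurable_funB.
Qed.

Lemma temperature_long_before t : 0 <= t <= t0 ->
  temperature a b Te P t =
  (a * K * t * expR (- (b * (t - t0))) + a / b * expR (- (b * t)) - a / b
   + Te)%:E.
Proof.
move=> /andP[t_ge0 tt0].
rewrite (@temperature_fin _ _ _ _ _ _
  (a * K * expR (b * t0) * t + (- (a / b)) * expR (b * t) -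
   (a * K * expR (b * t0) * 0 + (- (a / b)) * expR (b * 0)))).
  rewrite expR_shift expRN !mulr0 expR0; congr EFin.
  by have X0 := expR_neq0 (b * t); field; rewrite a_neq0 b_neq0 X0.
apply: integral_affexp => // x /andP[_ xt].
by rewrite heat_rate1// (le_trans xt).
Qed.

(** By [Kt0] the heat accumulated up to [t0] is [Td * expR (b * t0)]; from then on it grows exactly
    like [Td * expR (b * t)]. *)
Lemma temperature_long_after t : t0 <= t -> temperature a b Te P t = Tc%:E.
Proof.
move=> tt0.
have X0 := expR_neq0 (b * t).
rewrite (@temperature_fin _ _ _ _ _ _ (Td * expR (b * t))).
  by rewrite expRN; congr EFin; field.
rewrite (integral_affexp_glue (m := t0) (k := a * K * expR (b * t0))
  (c := - (a / b)) (g := b) (k' := 0) (c' := Td) (g' := b)).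
- rewrite !mulr0 expR0; congr EFin; apply/eqP; rewrite -subr_eq0; apply/eqP.
  have KZ := Kt0; set Z := expR (b * t0) in KZ *; set X := expR (b * t).
  transitivity ((a / b) * (1 - K * Z * (1 - b * t0))).
    by field; rewrite a_neq0 b_neq0.
  by rewrite KZ subrr mulr0.
- by rewrite (ltW t0_gt0).
- by move=> x /andP[_ /ltW]; exact: heat_rate1.
- by move=> x /andP[+ _]; exact: heat_rate2.
- move=> x /andP[_ xt]; rewrite -heat_rate1//.
  by rewrite !mulr_ge0 ?expR_ge0 ?Pstar_long_ge0// ltW.
- by move=> x _; rewrite add0r !mulr_ge0 ?expR_ge0// ltW.
Qed.

(** Before [t0] the slack is a positive multiple of the gap between the exponential at [b * t] and
    its tangent line at [b * t0], plus a term that [Kt0] makes zero. *)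
Lemma temperature_long_le t : 0 <= t -> (temperature a b Te P t <= Tc%:E)%E.
Proof.
move=> t_ge0; have [tt0|/ltW tt0] := leP t t0; last first.
  by rewrite temperature_long_after.
rewrite temperature_long_before ?t_ge0// lee_fin expR_shift expRN.
have X0 := expR_gt0 (b * t); have Z0 := expR_gt0 (b * t0).
have tangent : expR (b * t0) * (1 + b * (t - t0)) <= expR (b * t).
  rewrite (_ : b * t = b * t0 + b * (t - t0)); last by ring.
  by rewrite expRD ler_pM2l// expR_ge1Dx.
have KZ := Kt0; set Z := expR (b * t0) in KZ Z0 tangent *.
set X := expR (b * t) in X0 tangent *.
rewrite -subr_ge0.
rewrite (_ : _ - _ = a / (b * X) *
    (K * (X - Z * (1 + b * (t - t0))) + (K * Z * (1 - b * t0) - 1))); last first.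
  by field; rewrite a_neq0 b_neq0 gt_eqF.
rewrite KZ subrr addr0 mulr_ge0 ?divr_ge0 ?mulr_ge0 ?(ltW a_gt0)//;
  rewrite ?(ltW b_gt0) ?(ltW X0) ?(ltW K_gt0)//.
by rewrite subr_ge0.
Qed.

(** The value of the integral of [P / (1 + P)], split into the share of the constraint at the
    deadline and that of the constraint along [[t0, D]]. *)
Let A (D : R) := Td / (a * K) + Td * b / (a * K) * (D - t0).

Lemma integral_Pstar_long D : t0 <= D ->
  (\int[mu]_(x in `[0%R, D]) (P x / (1 + P x))%:E = (A D)%:E)%E.
Proof.
move=> t0D; have Z0 := expR_neq0 (b * t0).
have dK : 1 + Td * b / a = K by ring.
have rate1 x : x < t0 -> P x / (1 + P x) =
    1 + - (K * expR (b * t0) * b)^-1 * b * expR (b * x).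
  move=> xt; have X0 := expR_neq0 (b * x).
  rewrite /Pstar_long xt expR_shift [1 + _]addrC subrK.
  set k := K; have k0 : k != 0 := K_neq0.
  by field; rewrite b_neq0 k0 X0 Z0.
rewrite (integral_affexp_glue (m := t0) (k := 1)
  (c := - (K * expR (b * t0) * b)^-1) (g := b)
  (k' := Td * b / (a * K)) (c' := 0) (g' := 0)).
- rewrite !mulr0 expR0; congr EFin.
  apply/eqP; rewrite -subr_eq0; apply/eqP; rewrite /A.
  have KZ := Kt0; set Z := expR (b * t0) in KZ Z0 *; set k := K in KZ *.
  (* Expressing [Td] through [k] exposes the factor [1 - k * Z * (1 - b * t0)], which is zero by
     [Kt0]. *)
  have TdE : Td = (k - 1) * a / b by rewrite /k; field; rewrite a_neq0 b_neq0.
  have k0 : k != 0 := K_neq0.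
  transitivity ((1 - k * Z * (1 - b * t0)) / (k * Z * b)).
    by rewrite TdE; field; rewrite a_neq0 b_neq0 k0 Z0.
  by rewrite KZ subrr mul0r.
- by rewrite (ltW t0_gt0).
- by move=> x /andP[_]; exact: rate1.
- move=> x /andP[t0x _]; rewrite /Pstar_long ltNge t0x/= dK.
  by rewrite mul0r mul0r addr0 invfM mulrA.
- move=> x /andP[_ xt].
  rewrite (_ : _ + _ = 1 - expR (b * x) / expR (b * t0) / K); last first.
    set k := K; have k0 : k != 0 := K_neq0.
    by field; rewrite b_neq0 k0 Z0.
  rewrite subr_ge0 ler_pdivrMr// mul1r (le_trans _ (ltW K_gt1))//.
  by rewrite ler_pdivrMr ?expR_gt0// mul1r ler_expR ler_pM2l.
- move=> x _; rewrite !mul0r addr0 divr_ge0// mulr_ge0// ltW//.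
Qed.

(* Complementary slackness: [1 / (1 + P x)] is [exp (b x)] times a
   nonincreasing weight that varies only on [[t0, D]], where the temperature
   constraint is tight. *)
Lemma integral_long_le D E Q : t0 <= D -> feasible D E a b Te Tc Q ->
  (\int[mu]_(x in `[0%R, D]) (Q x / (1 + P x))%:E <= (A D)%:E)%E.
Proof.
move=> t0D [PQ TQ _]; have D0 : 0 <= D := le_trans (ltW t0_gt0) t0D.
set k := K; have k0 : k != 0 := K_neq0; have k_gt0 : 0 < k := K_gt0.
(* Multipliers of the temperature constraint: [v] is their density, [V x] its integral over
   [[x, D]], [w] the mass at the deadline, and [Y] the largest heat allowed. They are chosen so that
   [1 / (1 + P x) = a * expR (b * x) * (w + V x)] on [[0, D]]. *)
pose v (s : R) := if s < t0 then 0 else b / (a * k) * expR (- b * s).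
pose V (x : R) := (expR (- b * Num.max x t0) - expR (- b * D)) / (a * k).
pose Y (s : R) := Td * expR (b * s).
pose w := expR (- b * D) / (a * k).
have ak : 0 < a * k by rewrite mulr_gt0.
have v0 s : 0 <= v s.
  by rewrite /v; case: ifP => // _; rewrite mulr_ge0 ?expR_ge0// divr_ge0 ?ltW.
have vE s : t0 <= s -> v s = 0 + - (a * k)^-1 * - b * expR (- b * s).
  by move=> t0s; rewrite /v ltNge t0s/=; ring.
have mv : measurable_fun [set: R] v.
  apply: measurable_fun_ifT => //; first exact: measurable_fun_ltr.
  by apply: measurable_funM => //; exact: measurableT_comp.
have mV : measurable_fun `[0, D] V.
  rewrite /V; apply: measurable_funM => //; apply: measurable_funB => //.
  apply: measurableT_comp => //; apply: measurable_funM => //.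
  exact: measurable_maxr.
have mY : measurable_fun `[0, D] Y.
  rewrite /Y; apply: measurable_funM => //; exact: measurableT_comp.
have vV x : 0 <= x <= D -> (\int[mu]_(s in `[x, D]) (v s)%:E = (V x)%:E)%E.
  move=> /andP[x0 xD]; rewrite /V; have [xt0|/ltW t0x] := leP x t0.
    rewrite (integral_affexp_glue (m := t0) (k := 0) (c := 0) (g := 0)
      (k' := 0) (c' := - (a * k)^-1) (g' := - b)).
    - by congr EFin; ring.
    - by rewrite xt0.
    - by move=> s /andP[_ st]; rewrite /v st; ring.
    - by move=> s /andP[+ _]; exact: vE.
    - by move=> s _; rewrite !mul0r addr0.
    - by move=> s /andP[t0s _]; rewrite -vE.
  rewrite (integral_affexp (k := 0) (c := - (a * k)^-1) (g := - b))//.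
    by congr EFin; ring.
  by move=> s /andP[xs _]; rewrite vE// (le_trans t0x).
have -> : (\int[mu]_(x in `[0%R, D]) (Q x / (1 + P x))%:E =
    \int[mu]_(x in `[0%R, D]) (a * expR (b * x) * Q x * (w + V x))%:E)%E.
  apply: eq_integral => x _; congr EFin.
  rewrite /w /V -mulrDl [_ + (_ - _)]addrC subrK /Pstar_long.
  have X0 := expR_neq0 (b * x); have Z0 := expR_neq0 (b * t0).
  case: ltP => xt.
    rewrite expR_shift mulNr expRN [1 + _]addrC subrK -/k.
    by field; rewrite a_neq0 X0 Z0 k0.
  rewrite mulNr expRN [1 + _]addrC -/k.
  by field; rewrite a_neq0 X0 k0.
apply: le_trans (integral_weight_le D0 _ (measurable_heat_rate a b PQ)
  (heat_rate_ge0 b a_gt0 PQ) mv v0 mV vV mY _) _.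
- by rewrite divr_ge0 ?expR_ge0 ?ltW.
- move=> s sD; apply: heat_le_of_temperature_le => //; exact: TQ.
(* On [[t0, D]] the exponentials in [v] and [Y] cancel, so [v * Y] is constant there and the bound
   is exactly [A D]. *)
rewrite (integral_affexp_glue (m := t0) (k := 0) (c := 0) (g := 0)
      (k' := Td * b / (a * k)) (c' := 0) (g' := 0)).
- rewrite -EFinD lee_fin le_eqVlt; apply/orP; left; apply/eqP.
  rewrite /w /Y /A -/k mulNr expRN; have X0 := expR_neq0 (b * D).
  by field; rewrite a_neq0 X0 k0.
- by rewrite (ltW t0_gt0).
- by move=> s /andP[_ st]; rewrite /v st; ring.
- move=> s /andP[st _]; rewrite /v ltNge st/= /Y mulNr expRN.
  by have X0 := expR_neq0 (b * s); field; rewrite a_neq0 X0 k0.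
- by move=> s _; rewrite !mul0r addr0.
- by move=> s _; rewrite !mul0r addr0 divr_ge0 ?mulr_ge0 ?(ltW b_gt0) ?ltW.
Qed.

Lemma optimal_policy_long D E : t0 <= D -> (energy D P <= E%:E)%E ->
  optimal_policy D E a b Te Tc P.
Proof.
move=> t0D PE.
apply: optimal_policy_of_tangent (integral_Pstar_long t0D) _.
  split=> //; first exact: power_policy_Pstar_long.
  by move=> t /andP[+ _]; exact: temperature_long_le.
by move=> Q; exact: integral_long_le.
Qed.

End long_deadline.

(** * Deadline at or before the critical time *)

Section short_deadline.
Context {R : realType}.
Notation mu := (@lebesgue_measure R).
Variables (a b Te Tc t0 D : R).
Hypotheses (a_gt0 : 0 < a) (b_gt0 : 0 < b) (Te_lt_Tc : Te < Tc).
Hypotheses (D_gt0 : 0 < D) (D_le_t0 : D <= t0).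
Local Notation Td := (Tc - Te).
Local Notation K := (Td * b / a + 1).
Hypothesis Kt0 : K * expR (b * t0) * (1 - b * t0) = 1.
Local Notation P := (Pstar_short D a b Td).

(** The factor in [1 + P x = lambda * expR (- (b * x))]; its value brings the temperature to [Tc]
    exactly at the deadline. *)
Let lambda := 1 / D * ((Td / a + 1 / b) * expR (b * D) - 1 / b).

Let a_neq0 : a != 0. Proof. by rewrite gt_eqF. Qed.
Let b_neq0 : b != 0. Proof. by rewrite gt_eqF. Qed.
Let D_neq0 : D != 0. Proof. by rewrite gt_eqF. Qed.
Let Td_gt0 : 0 < Td. Proof. by rewrite subr_gt0. Qed.
Let K_gt1 : 1 < K. Proof. exact: gt1_K. Qed.
Let expR_neq0 (x : R) : expR x != 0. Proof. by rewrite gt_eqF ?expR_gt0. Qed.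

Let lambdaE : b * D * lambda = K * expR (b * D) - 1.
Proof. by rewrite /lambda; field; rewrite a_neq0 b_neq0 D_neq0. Qed.

(** Multiplied by [b * D] and combined with [lambdaE], this is [before_t0]; here [D <= t0]
    enters. *)
Let lambda_ge : K * expR (b * D) <= lambda.
Proof.
have h := before_t0 a_gt0 b_gt0 Td_gt0 Kt0 (ltW D_gt0) D_le_t0.
have bD : 0 < b * D by rewrite mulr_gt0.
rewrite -(ler_pM2l bD) lambdaE; set k := K * _ in h *; lra.
Qed.

Let lambda_gt0 : 0 < lambda.
Proof.
by apply: lt_le_trans lambda_ge; rewrite mulr_gt0 ?expR_gt0// (lt_trans ltr01).
Qed.

Let lambda_neq0 : lambda != 0. Proof. by rewrite gt_eqF. Qed.

Let heat_rate x : a * expR (b * x) * P x =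
  a * lambda + - (a / b) * b * expR (b * x).
Proof.
have X0 := expR_neq0 (b * x).
rewrite /Pstar_short -/lambda expRN.
by field; rewrite b_neq0 X0.
Qed.

Lemma power_policy_Pstar_short : power_policy D P.
Proof.
split=> [|x /andP[_ xD]].
  apply: measurable_funB => //; apply: measurable_funM => //.
  apply: measurableT_comp => //; apply: measurableT_comp => //.
rewrite /Pstar_short -/lambda expRN subr_ge0 ler_pdivlMr ?expR_gt0// mul1r.
apply: le_trans lambda_ge; rewrite -[leLHS]mul1r.
by rewrite ler_pM ?expR_ge0 ?(ltW K_gt1)// ler_expR ler_pM2l.
Qed.

Lemma temperature_short_le t : 0 <= t <= D ->
  (temperature a b Te P t <= Tc%:E)%E.
Proof.
move=> /andP[t_ge0 tD].
rewrite (@temperature_fin _ _ _ _ _ _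
  (a * lambda * t + - (a / b) * expR (b * t) -
   (a * lambda * 0 + - (a / b) * expR (b * 0)))); last first.
  by apply: integral_affexp => // x _; exact: heat_rate.
rewrite lee_fin expRN !mulr0 expR0.
have X0 := expR_gt0 (b * t).
have tangent : expR (b * D) * (1 + b * (t - D)) <= expR (b * t).
  rewrite (_ : b * t = b * D + b * (t - D)); last by ring.
  by rewrite expRD ler_pM2l ?expR_gt0// expR_ge1Dx.
have le := lambda_ge; have lE := lambdaE.
set Z := expR (b * D) in le lE tangent; set X := expR (b * t) in X0 tangent *.
rewrite -subr_ge0.
(* The slack is a tangent line gap at [b * D], plus a term that is nonnegative by [lambda_ge], plus
   a multiple of the difference that [lambdaE] makes zero. *)
rewrite (_ : _ - _ = a / (b * X) * (K * (X - Z * (1 + b * (t - D))) +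
    b * (D - t) * (lambda - K * Z) +
    (b * D * lambda - (K * Z - 1)) *- 1)); last first.
  by field; rewrite a_neq0 b_neq0 gt_eqF.
rewrite lE subrr mul0rn oppr0 addr0.
rewrite mulr_ge0 ?divr_ge0 ?mulr_ge0 ?(ltW a_gt0) ?(ltW b_gt0) ?(ltW X0)//.
by rewrite addr_ge0 ?mulr_ge0 ?subr_ge0// ltW// (lt_trans ltr01).
Qed.

(** The value of the integral of [P / (1 + P)]: the heat allowed at the deadline, divided by
    [a * lambda]. *)
Let A := Td * expR (b * D) / (a * lambda).

Lemma integral_Pstar_short :
  (\int[mu]_(x in `[0%R, D]) (P x / (1 + P x))%:E = A%:E)%E.
Proof.
rewrite (integral_affexp (k := 1) (c := - (lambda * b)^-1) (g := b)); last 2 first.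
- exact: ltW.
- move=> x _; have X0 := expR_neq0 (b * x).
  rewrite /Pstar_short -/lambda expRN [1 + _]addrC subrK.
  by field; rewrite b_neq0 X0 lambda_neq0.
rewrite !mulr0 expR0; congr EFin; apply/eqP; rewrite -subr_eq0; apply/eqP.
rewrite /A; have lE := lambdaE; set Z := expR (b * D) in lE *.
transitivity ((b * D * lambda - (K * Z - 1)) / (lambda * b)).
  by field; rewrite a_neq0 b_neq0 lambda_neq0.
by rewrite lE subrr mul0r.
Qed.

(* Only the temperature constraint at the deadline is used: [1 / (1 + P x)] is
   a constant multiple of [exp (b x)]. *)
Lemma integral_short_le E Q : feasible D E a b Te Tc Q ->
  (\int[mu]_(x in `[0%R, D]) (Q x / (1 + P x))%:E <= A%:E)%E.
Proof.
move=> [PQ TQ _].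
have -> : (\int[mu]_(x in `[0%R, D]) (Q x / (1 + P x))%:E =
    \int[mu]_(x in `[0%R, D]) ((a * lambda)^-1%:E * (a * expR (b * x) * Q x)%:E))%E.
  apply: eq_integral => x _; rewrite -EFinM; congr EFin.
  have X0 := expR_neq0 (b * x).
  rewrite /Pstar_short -/lambda expRN [1 + _]addrC subrK.
  by field; rewrite a_neq0 X0 lambda_neq0.
have al : 0 <= (a * lambda)^-1 by rewrite invr_ge0 mulr_ge0// ltW.
rewrite ge0_integralZl//=; last 2 first.
- by apply/measurable_EFinP; exact: measurable_heat_rate PQ.
- by move=> x; rewrite in_itv/= lee_fin => /(heat_rate_ge0 b a_gt0 PQ).
rewrite (_ : A = (a * lambda)^-1 * (Td * expR (b * D))) 1?[RHS]mulrC//.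
rewrite [leRHS]EFinM lee_wpmul2l ?lee_fin//.
by apply: heat_le_of_temperature_le => //; apply: TQ; rewrite lexx ltW.
Qed.

Lemma optimal_policy_short E : (energy D P <= E%:E)%E ->
  optimal_policy D E a b Te Tc P.
Proof.
move=> PE; apply: optimal_policy_of_tangent integral_Pstar_short _.
  split=> //; [exact: power_policy_Pstar_short|exact: temperature_short_le].
exact: integral_short_le.
Qed.

End short_deadline.

(** * Existence of the critical time and the two regimes together *)

Theorem mainTheorem6 (R : realType) (D E a b Te Tc : R)
    (D_gt0 : 0 < D) (E_gt0 : 0 < E) (a_gt0 : 0 < a) (b_gt0 : 0 < b)
    (Te_lt_Tc : Te < Tc) :
  let Td := Tc - Te in
  (exists t0, 0 < t0 /\ t0_equation a b Td t0) /\
  (forall t0, 0 < t0 -> t0_equation a b Td t0 ->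
     (t0 < D ->
      (energy D (Pstar_long a b Td t0) <= E%:E)%E ->
      [/\ optimal_policy D E a b Te Tc (Pstar_long a b Td t0),
          forall t, 0 <= t <= t0 ->
            temperature a b Te (Pstar_long a b Td t0) t =
            (a * (Td * b / a + 1) * t * expR (- (b * (t - t0)))
             + a / b * expR (- (b * t)) - a / b + Te)%:E
        & forall t, t0 <= t <= D ->
            temperature a b Te (Pstar_long a b Td t0) t = Tc%:E]) /\
     (D < t0 ->
      (energy D (Pstar_short D a b Td) <= E%:E)%E ->
      optimal_policy D E a b Te Tc (Pstar_short D a b Td))).
Proof.
move=> Td; have Td_gt0 : 0 < Td by rewrite subr_gt0.
split; first exact: t0_equation_solvable.
move=> t0 t0_gt0 /(t0_equationE _ a_gt0 b_gt0) Kt0; split=> [t0D PE|Dt0 PE].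
  split.
  - by apply: optimal_policy_long Kt0 _ _ _ _ => //; exact: ltW.
  - by move=> t; exact: temperature_long_before.
  - by move=> t /andP[+ _]; exact: temperature_long_after.
by apply: optimal_policy_short Kt0 _ _ => //; exact: ltW.
Qed.
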